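(* Let $p\geq 2$ and let $G$ be a $K_{1,p+1}$-free $2p$-regular graph. If $G$ is $(p+2)$-star colourable, then $-2$ and $p-2$ are eigenvalues of (the adjacency matrix of) $G$ with multiplicities at least $(p-1)(p+2)/2$ and $p+1$, respectively.
   Context: Graphs are finite and simple. $K_{1,p+1}$-free means no induced subgraph isomorphic to $K_{1,p+1}$. A $k$-star colouring is a proper colouring with $k$ colours such that the subgraph induced by any two colour classes has every connected component a star $K_{1,q}$ ($q\ge0$). *)

(* Defs.v *)
From mathcomp Require Import all_boot all_order all_algebra.

Set Implicit Arguments.
Unset Strict Implicit.
Unset Printing Implicit Defensive.

Import GRing.Theory Num.Theory.

Record sgraph := SGraph {
  vertex :> finType;
  adj : rel vertex;
  adj_sym : symmetric adj;
  adj_irrefl : irreflexive adj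
}.

Definition graph_iso (G H : sgraph) : Prop :=
  exists2 f : G -> H, bijective f & forall x y, adj (f x) (f y) = adj x y.

Section Induced.
Variables (G : sgraph) (A : {set G}).

Definition induced_rel : rel {x : G | x \in A} := fun x y => adj (val x) (val y).

Fact induced_sym : symmetric induced_rel.
Proof. by move=> x y; apply: adj_sym. Qed.

Fact induced_irrefl : irreflexive induced_rel.
Proof. by move=> x; apply: adj_irrefl. Qed.

Definition induced : sgraph := SGraph induced_sym induced_irrefl.
End Induced.

(* K_{1,q}: the centre is [None], the q leaves are the [Some i]. *)
Definition star_rel (q : nat) : rel (option 'I_q) :=
  fun x y => (x == None) != (y == None).

Fact star_sym q : symmetric (@star_rel q).
Proof. by move=> x y; rewrite /star_rel eq_sym. Qed.

Fact star_irrefl q : irreflexive (@star_rel q).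
Proof. by move=> x; rewrite /star_rel eqxx. Qed.

Definition star (q : nat) : sgraph := SGraph (@star_sym q) (@star_irrefl q).

Definition induced_free (H G : sgraph) : Prop :=
  forall A : {set G}, ~ graph_iso (induced A) H.

Definition regular (d : nat) (G : sgraph) : Prop :=
  forall v : G, #|[set u | adj v u]| = d.

Definition component (G : sgraph) (x : G) : {set G} :=
  [set y | connect (@adj G) x y].

Definition star_forest (G : sgraph) : Prop :=
  forall x : G, exists q : nat, graph_iso (induced (component x)) (star q).

Definition proper_colouring (G : sgraph) (k : nat) (f : G -> 'I_k) : Prop :=
  forall x y : G, adj x y -> f x != f y.

Definition star_colouring (G : sgraph) (k : nat) (f : G -> 'I_k) : Prop :=
  proper_colouring f /\
  forall i j : 'I_k, i != j ->
    star_forest (induced [set x | (f x == i) || (f x == j)]).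

(* Colours may be left unused. *)
Definition star_colourable (k : nat) (G : sgraph) : Prop :=
  exists f : G -> 'I_k, star_colouring f.

Definition adjmx (R : nzRingType) (G : sgraph) : 'M[R]_#|G| :=
  \matrix_(i, j) ((adj (enum_val i) (enum_val j))%:R)%R.

(* Dimension of the eigenspace; for a symmetric matrix over a real closed field
   this is also the multiplicity of [a] as a root of the characteristic
   polynomial. *)
Definition eigen_mult (F : fieldType) (n : nat) (A : 'M[F]_n) (a : F) : nat :=
  \rank (eigenspace A a).

(* Main.v *)
Require Import Defs.
From mathcomp Require Import all_boot all_order all_algebra.
From mathcomp Require Import zify ring.

Set Implicit Arguments.
Unset Strict Implicit.
Unset Printing Implicit Defensive.

Import GRing.Theory Num.Theory.

(* Let c v j be the number of neighbours of v of colour j. As there is no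
   bicoloured path on four vertices, every edge uv has c u (f v) = 1 or
   c v (f u) = 1. Since 2p > p + 1, at most p colours j satisfy c v j = 1, so
   double counting shows that exactly one of the two alternatives holds on each
   edge and that every v has a unique second colour h v (its hub colour) with
   c v (h v) = p. Being K_{1,p+1}-free then makes the partition of G by (f, h)
   equitable: a vertex of class (i, j) has one neighbour in each of the classes
   (k, i) and (j, k), k distinct from i and j. Functions of the class of the
   form x(i, j) = a(i) + a(j) with sum a = 0 are eigenvectors for p - 2, and
   symmetric x with vanishing row sums are eigenvectors for -2. *)

(** * Tight sums, induced stars and bicoloured walks *)

(** Turns a tight double count into termwise equalities; it serves for arcs, for vertices and for
    hub colours of neighbours. *)
Lemma leq_sum_eq (I : finType) (P : pred I) (E1 E2 : I -> nat) :
  (forall i, P i -> E1 i <= E2 i) ->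
  \sum_(i | P i) E2 i <= \sum_(i | P i) E1 i ->
  forall i, P i -> E1 i = E2 i.
Proof.
move=> le12 le21 i Pi; apply/eqP; move: i Pi; apply/forall_inP.
rewrite -(leqif_sum (fun i Pi => leqif_eq (le12 i Pi))).
by rewrite eqn_leq le21 andbT leq_sum.
Qed.

Lemma exists_notin3 n (a b c : 'I_n) :
  3 < n -> exists z, [/\ z != a, z != b & z != c].
Proof.
move=> n_gt3; have/set0Pn[z] : ~: [set a; b; c] != set0.
  rewrite -card_gt0 cardsCs setCK card_ord subn_gt0.
  apply: leq_ltn_trans n_gt3; rewrite setUC cardsU1 cards2.
  by case: (_ \notin _); case: (_ != _).
by rewrite !inE !negb_or => /andP[/andP[? ?] ?]; exists z.
Qed.

Lemma graph_iso_star (G : sgraph) (v : G) (L : {set G}) :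
  L \subset [set u | adj v u] -> {in L &, forall x y, ~~ adj x y} ->
  graph_iso (induced (v |: L)) (star #|L|).
Proof.
move=> /subsetP sL indL.
have vL : v \notin L by apply/negP => /sL; rewrite inE adj_irrefl.
(* [v] is not in [L], so its index in [enum L] is [#|L|] and [insub] sends it to [None], the
   centre. *)
pose g (x : induced (v |: L)) : star #|L| :=
  insub (index (val x) (enum L)) : option 'I_#|L|.
have iL y : (index y (enum L) < #|L|) = (y \in L).
  by rewrite cardE index_mem mem_enum.
have gN x : (g x == None) = (val x == v).
  rewrite /g; case: insubP => [i|].
    rewrite iL => xL _.
    by apply/esym/negbTE; apply: contraNneq vL => <-.
  rewrite iL eqxx => /negbTE xL.
  by have := valP x; rewrite !inE xL orbF => ->.
have inL (x : induced (v |: L)) : val x != v -> val x \in L.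
  by move=> /negbTE xv; have := valP x; rewrite !inE xv.
exists g.
  apply: inj_card_bij => [x y gxy|].
    apply: val_inj; have := gN x; rewrite gxy gN.
    case: (eqVneq (val y) v) => [-> /esym/eqP -> //|yv /esym/negbT xv].
    have xL := inL _ xv; have yL := inL _ yv.
    have := gxy; rewrite /g !insubT ?iL // => ? ? [] exy.
    have := congr1 (nth v (enum L)) exy.
    by rewrite !nth_index ?mem_enum.
  by rewrite card_option card_ord card_sig cardsU1 vL.
move=> x y; rewrite /adj /= /star_rel /induced_rel !gN.
case: (eqVneq (val x) v) => [->|xv]; case: (eqVneq (val y) v) => [->|yv] /=.
- by rewrite adj_irrefl.
- by have := sL _ (inL _ yv); rewrite inE => ->.
- by have := sL _ (inL _ xv); rewrite inE adj_sym => ->.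
- by apply/esym/negbTE/indL; apply: inL.
Qed.

Lemma induced_free_star (G : sgraph) q (v : G) (L : {set G}) :
  induced_free (star q) G -> #|L| = q -> L \subset [set u | adj v u] ->
  exists2 x, x \in L & exists2 y, y \in L & adj x y.
Proof.
move=> free Lq sL.
suff: ~~ [forall x in L, forall y in L, ~~ adj x y].
  case/forall_inPn=> x xL /forall_inPn[y yL]; rewrite negbK => xy.
  by exists x => //; exists y.
apply/negP=> /forall_inP ind; apply: (free (v |: L)); rewrite -Lq.
by apply: graph_iso_star => // x y xL yL; have /forall_inP := ind x xL; apply.
Qed.

(** Every edge of a star meets the centre in one end, so a walk visits the centre at every other
    vertex: [x] and [z] are both the centre, or [y] and [w] are. *)
Lemma star_forest_noP4 (G : sgraph) (x y z w : G) :
  star_forest G -> adj x y -> adj y z -> adj z w -> x = z \/ y = w.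
Proof.
move=> /(_ x)[q [g bij_g isog]] xy yz zw.
have Cx : x \in component x by rewrite inE connect0.
have Cy : y \in component x by rewrite inE connect1.
have Cz : z \in component x.
  by rewrite inE (connect_trans (connect1 xy)) ?connect1.
have Cw : w \in component x.
  by rewrite inE (connect_trans (connect1 xy)) // (connect_trans (connect1 yz)) ?connect1.
pose x' : induced (component x) := exist _ x Cx.
pose y' : induced (component x) := exist _ y Cy.
pose z' : induced (component x) := exist _ z Cz.
pose w' : induced (component x) := exist _ w Cw.
have gxy : adj (g x') (g y') by rewrite isog.
have gyz : adj (g y') (g z') by rewrite isog.
have gzw : adj (g z') (g w') by rewrite isog.
have g_inj := bij_inj bij_g.
suff [/g_inj/(congr1 val)|/g_inj/(congr1 val)] : g x' = g z' \/ g y' = g w'.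
- by left.
- by right.
move: gxy gyz gzw; rewrite /adj /= /star_rel.
by case: (g x') (g y') (g z') (g w') => [?|] [?|] [?|] [?|] //; auto.
Qed.

Lemma star_colouring_noP4 (G : sgraph) k (f : G -> 'I_k) (x y z w : G) :
  star_colouring f -> adj x y -> adj y z -> adj z w -> f x = f z -> f y = f w ->
  x = z \/ y = w.
Proof.
move=> [prop sf] xy yz zw fxz fyw.
pose A := [set u | (f u == f x) || (f u == f y)].
have Ax : x \in A by rewrite inE eqxx.
have Ay : y \in A by rewrite inE eqxx orbT.
have Az : z \in A by rewrite inE fxz eqxx.
have Aw : w \in A by rewrite inE fyw eqxx orbT.
have [] := @star_forest_noP4 (induced A) (exist _ x Ax) (exist _ y Ay)
  (exist _ z Az) (exist _ w Aw) (sf _ _ (prop _ _ xy)) xy yz zw.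
- by move/(congr1 val); left.
- by move/(congr1 val); right.
Qed.

(** * Neighbours counted by colour, and the double count over arcs *)

Definition cdeg (G : sgraph) k (f : G -> 'I_k) (v : G) (j : 'I_k) :=
  #|[set u | adj v u & f u == j]|.

Section ColourDegrees.
Variables (G : sgraph) (p : nat) (f : G -> 'I_(p + 2)).
Hypotheses (p_gt1 : 1 < p) (regG : regular (2 * p) G) (starf : star_colouring f).

Let properf : proper_colouring f := proj1 starf.

Lemma cdeg_own v : cdeg f v (f v) = 0.
Proof.
apply/eqP; rewrite cards_eq0; apply/eqP/setP=> u; rewrite !inE.
by apply/negP=> /andP[/properf]; rewrite eq_sym => /negbTE ->.
Qed.

Lemma cdeg_gt0 v u : adj v u -> 0 < cdeg f v (f u).
Proof. by move=> vu; apply/card_gt0P; exists u; rewrite inE vu eqxx. Qed.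

Lemma sum_cdeg v : \sum_j cdeg f v j = 2 * p.
Proof.
rewrite -(regG v) -sum1_card (partition_big f xpredT) //=.
apply: eq_bigr => j _; rewrite /cdeg -sum1_card.
by apply: eq_bigl => u; rewrite !inE.
Qed.

Definition unit_colours v := [set j | cdeg f v j == 1].

Lemma unit_colours_sub v : unit_colours v \subset [set~ f v].
Proof. by apply/subsetP=> j; rewrite !inE; apply: contraTneq => ->; rewrite cdeg_own. Qed.

(** If all p + 1 colours other than [f v] occurred exactly once around [v], the degree would be p +
    1, which is less than 2p. *)
Lemma card_unit_colours_le v : #|unit_colours v| <= p.
Proof.
have cU : #|[set~ f v]| = p.+1 by rewrite cardsC1 card_ord addn2.
have := subset_leqif_cards (unit_colours_sub v); rewrite cU => -[le_p1 eqE].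
move: le_p1; rewrite leq_eqVlt eqE ltnS => /orP[/eqP uE|//].
have := sum_cdeg v; rewrite (bigD1 (f v)) //= cdeg_own add0n.
rewrite (eq_bigr (fun=> 1)) => [|j jv].
  by rewrite sum1_card cardC1 card_ord; lia.
by apply/eqP; have : j \in unit_colours v by [rewrite uE !inE]; rewrite inE.
Qed.

Lemma card_unit_colours_sum v :
  #|unit_colours v| = \sum_(u | adj v u) (cdeg f v (f u) == 1).
Proof.
rewrite (partition_big f xpredT) //= -sum1_card big_mkcond /=.
apply: eq_bigr => j _; rewrite inE.
rewrite (eq_bigr (fun=> (cdeg f v j == 1) : nat)); last first.
  by move=> u /andP[_ /eqP ->].
rewrite sum_nat_const.
have -> : #|[pred u | adj v u && (f u == j)]| = cdeg f v j.
  by rewrite /cdeg cardsE.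
by case: eqP => [->|_]; rewrite ?muln1 ?muln0.
Qed.

(** Otherwise [v] has a second neighbour x coloured like [u], and [u] a second neighbour y coloured
    like [v]; then x, v, u, y is a forbidden bicoloured walk. *)
Lemma edge_unit v u : adj v u ->
  0 < (cdeg f v (f u) == 1) + (cdeg f u (f v) == 1).
Proof.
move=> vu; have uv : adj u v by rewrite adj_sym.
rewrite lt0n addn_eq0 !eqb0; apply/negP=> /andP[n1 n2].
have /card_gt1P[a [b [+ + ab]]] : 1 < cdeg f v (f u) by rewrite ltn_neqAle eq_sym n1 cdeg_gt0.
have /card_gt1P[c [d [+ + cd]]] : 1 < cdeg f u (f v) by rewrite ltn_neqAle eq_sym n2 cdeg_gt0.
rewrite !inE => /andP[uc /eqP fc] /andP[ud /eqP fd] /andP[va /eqP fa] /andP[vb /eqP fb].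
have [x [vx fx xu]] : exists x, [/\ adj v x, f x = f u & x <> u].
  by case: (eqVneq a u) ab => [->|/eqP]; [exists b|exists a]; split=> //; apply/eqP; rewrite eq_sym.
have [y [uy fy yv]] : exists y, [/\ adj u y, f y = f v & y <> v].
  by case: (eqVneq c v) cd => [->|/eqP]; [exists d|exists c]; split=> //; apply/eqP; rewrite eq_sym.
have xv : adj x v by rewrite adj_sym.
by case: (star_colouring_noP4 starf xv vu uy fx (esym fy)) => [/xu|/esym/yv].
Qed.

(** Edges are counted as ordered pairs, so each is seen from both ends; this is the factor 2. *)
Let sum_unit : \sum_(e : G * G | adj e.1 e.2)
    ((cdeg f e.1 (f e.2) == 1) + (cdeg f e.2 (f e.1) == 1)) =
  2 * \sum_v #|unit_colours v|.
Proof.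
rewrite big_split /= mul2n -addnn; congr (_ + _).
  under [RHS]eq_bigr => v _ do rewrite card_unit_colours_sum.
  by rewrite pair_big_dep.
under [RHS]eq_bigr => v _ do rewrite card_unit_colours_sum.
rewrite [RHS](exchange_big_dep xpredT) //= pair_big_dep.
by apply: eq_bigl => e /=; rewrite adj_sym.
Qed.

Let sum_edges : \sum_(e : G * G | adj e.1 e.2) 1 = 2 * (#|G| * p).
Proof.
rewrite -(pair_big_dep xpredT (@adj G) (fun _ _ => 1)) /=.
rewrite (eq_bigr (fun=> 2 * p)) => [|v _]; first by rewrite sum_nat_const mulnCA.
by rewrite sum1_card -(regG v) cardsE.
Qed.

Let sum_unit_le : \sum_v #|unit_colours v| <= #|G| * p.
Proof. by rewrite -sum_nat_const leq_sum // => v _; apply: card_unit_colours_le. Qed.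

Let sum_edges_le :
  \sum_(e : G * G | adj e.1 e.2) 1 <= \sum_(e : G * G | adj e.1 e.2)
    ((cdeg f e.1 (f e.2) == 1) + (cdeg f e.2 (f e.1) == 1)).
Proof. by apply: leq_sum => e /edge_unit. Qed.

(** There are 2p[#|G|] arcs. The sum over them is at least that by [edge_unit], and at most that
    since a vertex has at most p unit colours; so every term is 1. *)
Lemma edge_unit_eq1 v u : adj v u ->
  (cdeg f v (f u) == 1) + (cdeg f u (f v) == 1) = 1.
Proof.
move=> vu; symmetry.
pose E2 (e : G * G) := (cdeg f e.1 (f e.2) == 1) + (cdeg f e.2 (f e.1) == 1).
apply: (@leq_sum_eq _ (fun e => adj e.1 e.2) (fun=> 1) E2 _ _ (v, u)) => //.
  by move=> e /edge_unit.
by rewrite sum_unit sum_edges leq_mul2l sum_unit_le.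
Qed.

Lemma card_unit_colours v : #|unit_colours v| = p.
Proof.
apply: (leq_sum_eq (P := xpredT) (E1 := fun v => #|unit_colours v|)) => // [w _|].
  exact: card_unit_colours_le.
move: sum_edges_le; rewrite sum_unit sum_edges leq_mul2l /=.
by rewrite sum_nat_const.
Qed.

(** * The hub colour and the orientation of edges *)

Lemma exists_hub_colour v : exists j, (j != f v) && (cdeg f v j != 1).
Proof.
have /set0Pn[j] : [set~ f v] :\: unit_colours v != set0.
  rewrite -card_gt0 cardsD (setIidPr (unit_colours_sub v)).
  by rewrite cardsC1 card_ord card_unit_colours; lia.
by rewrite !inE => /andP[? ?]; exists j; apply/andP.
Qed.

(** By [unit_coloursE] only one colour qualifies, so the choice made by [xchoose] is immaterial. *)
Definition hub v : 'I_(p + 2) := xchoose (exists_hub_colour v).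

Lemma hub_neq v : hub v != f v.
Proof. by have /andP[] := xchooseP (exists_hub_colour v). Qed.

Lemma cdeg_hub_neq1 v : cdeg f v (hub v) != 1.
Proof. by have /andP[] := xchooseP (exists_hub_colour v). Qed.

Lemma unit_coloursE v : unit_colours v = ~: [set f v; hub v].
Proof.
apply/eqP; rewrite eqEcard; apply/andP; split.
  apply/subsetP=> j jU; rewrite !inE negb_or.
  have := subsetP (unit_colours_sub v) _ jU; rewrite !inE => -> /=.
  by apply: contraTneq jU => ->; rewrite inE cdeg_hub_neq1.
by rewrite cardsCs setCK card_ord cards2 card_unit_colours eq_sym hub_neq; lia.
Qed.

Lemma cdeg_other v k : k != f v -> k != hub v -> cdeg f v k = 1.
Proof.
move=> kf kh; apply/eqP; have : k \in unit_colours v.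
  by rewrite unit_coloursE !inE negb_or kf.
by rewrite inE.
Qed.

(** The p unit colours use up p of the 2p neighbours; the rest have the hub colour. *)
Lemma cdeg_hub v : cdeg f v (hub v) = p.
Proof.
have := sum_cdeg v; rewrite (bigD1 (f v)) //= cdeg_own (bigD1 (hub v)) ?hub_neq //=.
rewrite (eq_bigr (fun=> 1)) => [|j /andP[? ?]]; last exact: cdeg_other.
rewrite sum1_card -[X in _ + (_ + X)]cardsE.
have -> : [set j | j != f v & j != hub v] = unit_colours v.
  by apply/setP=> j; rewrite unit_coloursE !inE negb_or.
by rewrite card_unit_colours; lia.
Qed.

(** Along an edge the count differs from 1 exactly at the hub colour, so [edge_unit_eq1] orients the
    edge: just one end has the other's colour as its hub colour. *)
Lemma edge_hub v u : adj v u -> (f u == hub v) = (f v != hub u).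
Proof.
have H x y : adj x y -> (cdeg f x (f y) == 1) = (f y != hub x).
  move=> xy; have [->|nh] := eqVneq (f y) (hub x); first exact/negbTE/cdeg_hub_neq1.
  by rewrite cdeg_other // eq_sym; apply: properf.
move=> vu; have := edge_unit_eq1 vu; rewrite !H // 1?adj_sym //.
by do 2!case: (_ == _).
Qed.

(** * The equitable partition by colour and hub colour *)

Hypothesis freeG : induced_free (star p.+1) G.

Lemma exists_hub_nbr v k : k != f v -> k != hub v ->
  exists w, [/\ adj v w, f w = hub v & hub w = k].
Proof.
move=> kf kh; have /eqP/cards1P[u uE] := cdeg_other kf kh.
have : u \in [set u] by rewrite inE.
rewrite -uE inE => /andP[vu /eqP fu].
(* The p hub-coloured neighbours together with [u] are too many to be independent; the former are
   pairwise nonadjacent, so [u] is adjacent to one of them. *)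
pose L := u |: [set w | adj v w & f w == hub v].
have Lp : #|L| = p.+1.
  by rewrite cardsU1 inE vu fu (negbTE kh) -[in RHS](cdeg_hub v).
have sL : L \subset [set w | adj v w].
  by apply/subsetP=> w; rewrite !inE => /orP[/eqP ->|/andP[]].
have [w [vw fw uw]] : exists w, [/\ adj v w, f w = hub v & adj u w].
  have [x + [y + xy]] := induced_free_star freeG Lp sL.
  rewrite !inE => /orP[/eqP xu|/andP[vx /eqP fx]] /orP[/eqP yu|/andP[vy /eqP fy]].
  - by move: xy; rewrite xu yu adj_irrefl.
  - by exists y; rewrite -xu.
  - by exists x; split=> //; rewrite adj_sym -yu.
  - by have := properf xy; rewrite fx fy eqxx.
exists w; split=> //.
(* As [k] is not [hub v], the edge [vu] gives [hub u = f v]; this differs from [f w], so the edge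
   [uw] gives [hub w = f u = k]. *)
have := edge_hub vu; rewrite fu (negbTE kh) => /esym/negbFE/eqP hu.
have := edge_hub uw; rewrite -hu fw (negbTE (hub_neq v)) fu.
by move/esym/negbFE/eqP.
Qed.

(** The p neighbours of colour [hub v] have their hub colours among the p colours other than [f v]
    and [hub v], and each of these is attained. *)
Lemma card_hub_nbr v k : k != f v -> k != hub v ->
  #|[set w | (adj v w && (f w == hub v)) && (hub w == k)]| = 1.
Proof.
move=> kf kh.
have P1 j : j != f v /\ j != hub v -> j \in ~: [set f v; hub v].
  by case=> jf jh; rewrite !inE negb_or jf.
symmetry; apply: (leq_sum_eq (P := mem (~: [set f v; hub v])) (E1 := fun=> 1)
  (E2 := fun k => #|[set w | (adj v w && (f w == hub v)) && (hub w == k)]|)).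
- move=> j; rewrite !inE negb_or => /andP[jf jh].
  have [w [vw fw hw]] := exists_hub_nbr jf jh.
  by apply/card_gt0P; exists w; rewrite inE vw fw hw !eqxx.
- rewrite sum1_card -unit_coloursE card_unit_colours.
  apply: leq_trans (eq_leq (cdeg_hub v)).
  rewrite /cdeg -[in X in _ <= X]sum1_card.
  rewrite [X in _ <= X](partition_big hub (mem (unit_colours v))) /=.
    apply: eq_leq; apply: eq_bigr => j _; rewrite -sum1_card.
    by apply: eq_bigl => w; rewrite !inE.
  move=> w; rewrite inE => /andP[vw /eqP fw].
  rewrite unit_coloursE !inE negb_or -fw hub_neq andbT.
  by have := edge_hub vw; rewrite fw eqxx eq_sym => <-.
- exact: P1.
Qed.

Lemma sum_nbr (V : nmodType) (g : 'I_(p + 2) -> 'I_(p + 2) -> V) v :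
  (\sum_(u | adj v u) g (f u) (hub u) =
   \sum_(k | (k != f v) && (k != hub v)) (g k (f v) + g (hub v) k))%R.
Proof.
rewrite (bigID (fun u => f u == hub v)) /= addrC big_split /=; congr (_ + _)%R.
  rewrite (partition_big f (fun k => (k != f v) && (k != hub v))) /=; last first.
    by move=> u /andP[vu ->]; rewrite andbT eq_sym properf.
  apply: eq_bigr => k /andP[kf kh].
  have /eqP/cards1P[u uE] := cdeg_other kf kh.
  have uP w : (adj v w && (f w == k)) = (w == u).
    by move/setP/(_ w): uE; rewrite !inE.
  rewrite (big_pred1 u) => [|w]; last first.
    rewrite /= -uP; case: (eqVneq (f w) k) => [->|]; last by rewrite !andbF.
    by rewrite kh !andbT.
  have := uP u; rewrite eqxx => /andP[vu /eqP fu].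
  by have := edge_hub vu; rewrite fu (negbTE kh) => /esym/negbFE/eqP <-.
rewrite (partition_big hub (fun k => (k != f v) && (k != hub v))) /=; last first.
  move=> u /andP[vu /eqP fu].
  rewrite -fu hub_neq andbT.
  by have := edge_hub vu; rewrite fu eqxx eq_sym => <-.
apply: eq_bigr => k /andP[kf kh].
have /eqP/cards1P[u uE] := card_hub_nbr kf kh.
have uP w : (adj v w && (f w == hub v) && (hub w == k)) = (w == u).
  by move/setP/(_ w): uE; rewrite !inE.
rewrite (big_pred1 u) //.
by have := uP u; rewrite eqxx => /andP[/andP[_ /eqP ->] /eqP ->].
Qed.

(* Classes (i, j) and (j, k) are joined by an edge whenever k is neither i nor
   j, and any two arcs of the complete digraph on at least four vertices are
   linked by a walk that never backtracks. *)
Lemma exists_class i j : 0 < #|G| -> i != j -> exists v, f v = i /\ hub v = j.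
Proof.
move=> /card_gt0P[v0 _]; rewrite eq_sym => ji.
have p3 : 3 < p + 2 by lia.
have step v k : k != f v -> k != hub v -> exists w, f w = hub v /\ hub w = k.
  by move=> kf kh; have [w [_ ? ?]] := exists_hub_nbr kf kh; exists w.
(* Two steps lead from ([f v], [hub v]) through ([hub v], [i]) to ([i], [j]); the later claims add
   steps to reach these side conditions. *)
have fin v : hub v != i -> hub v != j -> f v != i ->
    exists w, f w = i /\ hub w = j.
  move=> hi hj fi.
  have [w [fw hw]] : exists w, f w = hub v /\ hub w = i.
    by apply: step; rewrite eq_sym.
  by rewrite -hw; apply: step; rewrite ?fw ?hw // eq_sym.
have mid v : hub v != i -> hub v != j -> exists w, f w = i /\ hub w = j.
  move=> hi hj; have [fi|] := eqVneq (f v) i; last exact: fin.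
  have [z [zi zj zh]] := exists_notin3 i j (hub v) p3.
  have [|w [fw hw]] := @step v z _ zh; first by rewrite fi.
  by apply: (fin w); rewrite ?hw ?fw.
have [z [zi zj zf]] := exists_notin3 i j (f v0) p3.
have [zh|zh] := eqVneq z (hub v0); first by apply: (mid v0); rewrite -zh.
by have [w [fw hw]] := step _ _ zf zh; apply: (mid w); rewrite hw.
Qed.

End ColourDegrees.

(** * Lifting functions on colours and on pairs of colours to eigenvectors *)

Section Eigenspaces.
Variables (R : rcfType) (G : sgraph) (p : nat) (f : G -> 'I_(p + 2)).
Hypotheses (p_gt1 : 1 < p) (ntG : 0 < #|G|) (regG : regular (2 * p) G).
Hypotheses (starf : star_colouring f) (freeG : induced_free (star p.+1) G).

Local Notation n := (p + 2).
Local Notation h := (hub p_gt1 regG starf).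
Local Open Scope ring_scope.

Let pair (v : G) : {set 'I_n} := [set f v; h v].
Let E2 := [set e : {set 'I_n} | #|e| == 2].

Let exists_pair e : e \in E2 -> exists v, pair v = e.
Proof.
rewrite inE => /cards2P[i [j [ij ->]]].
have [v [fv hv]] := exists_class p_gt1 regG starf freeG ntG ij.
by exists v; rewrite /pair fv hv.
Qed.

Let exists_pair_in i j : i != j -> exists v, forall k, (k \in pair v) = (k == i) || (k == j).
Proof.
move=> ij; have ijE : [set i; j] \in E2 by rewrite inE cards2 ij.
by have [v vE] := exists_pair ijE; exists v => k; rewrite vE !inE.
Qed.

(** Acting on row vectors, [M] lifts x to x([pair v]) and [Q] lifts a to a([f v]) + a([h v]). [N] is
    the incidence matrix of the complete graph on the colours; its left kernel is the symmetric x
    with vanishing row sums. *)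
Let M : 'M[R]_(#|E2|, #|G|) := \matrix_(e, v) (enum_val e == pair (enum_val v))%:R.
Let N : 'M[R]_(#|E2|, n) :=
  \matrix_(e, i) (i \in (enum_val e : {set 'I_n}))%:R.
Let Q : 'M[R]_(n, #|G|) := \matrix_(i, v) (i \in pair (enum_val v))%:R.
Let J : 'M[R]_(n, #|G|) := const_mx 1.

Let mulmx_adj m (F : 'I_m -> 'I_n -> 'I_n -> R) i v :
  ((\matrix_(i < m, u < #|G|) F i (f (enum_val u)) (h (enum_val u))) *m adjmx R G) i v =
  \sum_(k | (k != f (enum_val v)) && (k != h (enum_val v)))
     (F i k (f (enum_val v)) + F i (h (enum_val v)) k).
Proof.
rewrite -(sum_nbr _ _ _ freeG (F i)) mxE [RHS]big_mkcond /=.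
rewrite [RHS](reindex_onto (@enum_val _ predT) (@enum_rank _)) /=; last first.
  by move=> u _; rewrite enum_rankK.
apply: eq_big => u; first by rewrite enum_valK eqxx.
by move=> _; rewrite !mxE adj_sym; case: adj; rewrite ?mulr1 ?mulr0.
Qed.

Let sum_pair_eq (e : {set 'I_n}) i : #|e| = 2%N ->
  \sum_(k | k != i) (e == [set i; k])%:R = (i \in e)%:R :> R.
Proof.
move=> /eqP/cards2P[a [b [ab ->]]].
wlog ia : a b ab / i == a => [W|].
  have [/W|ia] := boolP (i == a); first exact.
  have [ib|ib] := boolP (i == b).
    by rewrite setUC; apply: W; rewrite // eq_sym.
  rewrite big1 => [|k _]; first by rewrite !inE (negbTE ia) (negbTE ib).
  case: eqP => // eab; have : i \in [set a; b] by rewrite eab !inE eqxx.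
  by rewrite !inE (negbTE ia) (negbTE ib).
rewrite (eqP ia) (bigD1 b) 1?eq_sym //= eqxx big1 ?addr0 => [|k /andP[ka kb]].
  by rewrite !inE eqxx.
case: eqP => // eab; have : k \in [set a; b] by rewrite eab !inE eqxx orbT.
by rewrite !inE (negbTE ka) (negbTE kb).
Qed.

Let M_adj : M *m adjmx R G = N *m Q - 2%:R *: M.
Proof.
apply/matrixP=> e v; rewrite (mulmx_adj (fun e i j => (enum_val e == [set i; j])%:R)).
rewrite !mxE; set w := enum_val v; set i := f w; set j := h w.
have ji : j != i by apply: hub_neq.
have e2 : #|enum_val e| = 2%N by have := enum_valP e; rewrite inE => /eqP.
have iE := sum_pair_eq i e2; have jE := sum_pair_eq j e2.
(* The terms split off are two copies of the entry of [M]; they account for the summand -2[M]. *)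
rewrite (bigD1 j) //= in iE; rewrite (bigD1 i) 1?eq_sym //= in jE.
rewrite big_split /=.
under eq_bigr => k _ do rewrite setUC.
under [X in _ + X]eq_bigl => k do rewrite andbC.
have -> : \sum_k N e k * Q k v = (i \in enum_val e)%:R + (j \in enum_val e)%:R.
  rewrite (bigD1 i) //= (bigD1 j) //= big1 => [|k /andP[ki kj]].
    by rewrite addr0 !mxE !inE !eqxx orbT !mulr1.
  by rewrite !mxE !inE (negbTE ki) (negbTE kj) mulr0.
rewrite -iE -jE /pair -/i -/j [[set j; i]]setUC.
by rewrite [_ == enum_val e]eq_sym; ring.
Qed.

(** The rows are nonzero, since every pair of colours occurs, and have disjoint supports. *)
Let row_free_M : row_free M.
Proof.
apply: inj_row_free => x xM0; apply/rowP=> e.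
have [v vE] := exists_pair (enum_valP e).
have := congr1 (fun A : 'rV_#|G| => A 0 (enum_rank v)) xM0.
rewrite !mxE (bigD1 e) //= big1 => [|e' e'e].
  by rewrite !mxE enum_rankK vE eqxx mulr1 addr0.
by rewrite !mxE enum_rankK vE (inj_eq enum_val_inj) (negbTE e'e) mulr0.
Qed.

Let card_E2 : #|E2| = 'C(n, 2).
Proof. by rewrite card_draws card_ord. Qed.

(** [M] embeds the left kernel of [N], of dimension at least C(p + 2, 2) - (p + 2) = (p - 1)(p +
    2)/2, into the eigenspace. *)
Lemma eigen_mult_neg2 :
  (((p - 1) * (p + 2)) %/ 2 <= eigen_mult (adjmx R G) (- 2%:R))%N.
Proof.
have sK : (kermx N *m M <= eigenspace (adjmx R G) (- 2%:R))%MS.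
  apply/eigenspaceP; rewrite -mulmxA M_adj mulmxBr mulmxA mulmx_ker mul0mx sub0r.
  by rewrite -scalemxAr scaleNr.
apply: leq_trans (mxrankS sK); rewrite mxrankMfree // mxrank_ker.
apply: leq_trans (leq_sub2l _ (rank_leq_col N)).
rewrite card_E2 bin2 -divn2; nia.
Qed.

(** For a row l in the pair of v, each of the p colours k contributes 1, and p = (p - 2) + 2; for
    other l only k = l contributes, twice. *)
Let Q_adj : Q *m adjmx R G = (p%:R - 2%:R) *: Q + 2%:R *: J.
Proof.
apply/matrixP=> l v.
have -> : Q = \matrix_(l, u) (l \in [set f (enum_val u); h (enum_val u)])%:R by [].
rewrite (mulmx_adj (fun l i j => (l \in [set i; j])%:R)).
rewrite !mxE; set w := enum_val v; set i := f w; set j := h w.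
have ji : j != i by apply: hub_neq.
have cardP : \sum_(k | (k != i) && (k != j)) 1 = p%:R :> R.
  rewrite sumr_const -[X in _ *+ X]cardsE.
  have -> : [set k | (k != i) && (k != j)] = ~: [set i; j].
    by apply/setP=> k; rewrite !inE negb_or.
  by rewrite cardsCs setCK card_ord cards2 eq_sym ji addnK.
have [li|li] := eqVneq l i.
  rewrite -cardP !inE li eqxx mulr1 mulr1 subrK.
  apply: eq_bigr => k /andP[ki kj].
  by rewrite !inE eqxx orbT ![i == _]eq_sym (negbTE ki) (negbTE ji) addr0.
have [lj|lj] := eqVneq l j.
  rewrite -cardP !inE lj eqxx orbT mulr1 mulr1 subrK.
  apply: eq_bigr => k /andP[ki kj].
  by rewrite !inE eqxx [j == k]eq_sym (negbTE kj) (negbTE ji) add0r.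
rewrite (bigD1 l) ?li //= big1 => [|k /andP[/andP[ki kj] kl]].
  by rewrite !inE !eqxx (negbTE li) (negbTE lj) orbT mulr0 add0r addr0 mulr1.
by rewrite !inE [l == k]eq_sym (negbTE kl) (negbTE li) (negbTE lj) addr0.
Qed.

(** A kernel vector changes sign between any two colours; going round three distinct colours makes
    it equal to its own negative. *)
Let row_free_Q : row_free Q.
Proof.
apply: inj_row_free => x xQ0.
have xN i j : i != j -> x 0 i = - x 0 j.
  move=> ij; have [v vE] := exists_pair_in ij.
  have := congr1 (fun A : 'rV_#|G| => A 0 (enum_rank v)) xQ0.
  rewrite !mxE (bigD1 i) //= (bigD1 j) 1?eq_sym //= big1 => [|k /andP[ki kj]].
    rewrite !mxE enum_rankK !vE !eqxx orbT !mulr1 addr0 => /eqP.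
    by rewrite addr_eq0 => /eqP.
  by rewrite !mxE enum_rankK vE (negbTE ki) (negbTE kj) mulr0.
apply/rowP=> i; rewrite mxE.
have n_gt3 : (3 < n)%N by lia.
have [j [ji _ _]] := exists_notin3 i i i n_gt3.
have [k [ki kj _]] := exists_notin3 i j j n_gt3.
apply/eqP; rewrite -eqNr; apply/eqP.
by rewrite -(xN k i) // (xN k j) // -(xN i j) // eq_sym.
Qed.

(** Vectors with sum zero kill the [J] term, and they form a space of dimension at least (p + 2) -
    1. *)
Lemma eigen_mult_sub2 :
  (p + 1 <= eigen_mult (adjmx R G) (p%:R - 2%:R))%N.
Proof.
pose c : 'cV[R]_n := const_mx 1.
have JE : J = c *m (const_mx 1 : 'rV_#|G|).
  by apply/matrixP=> i v; rewrite !mxE big_ord1 !mxE mulr1.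
have sK : (kermx c *m Q <= eigenspace (adjmx R G) (p%:R - 2%:R))%MS.
  apply/eigenspaceP; rewrite -mulmxA Q_adj mulmxDr -!scalemxAr JE.
  by rewrite [X in _ + _ *: X]mulmxA mulmx_ker mul0mx scaler0 addr0.
apply: leq_trans (mxrankS sK); rewrite mxrankMfree // mxrank_ker.
by have := rank_leq_col c; lia.
Qed.

End Eigenspaces.

Lemma eigen_mult_gt0 (F : fieldType) n (A : 'M[F]_n) a :
  0 < eigen_mult A a -> eigenvalue A a.
Proof. by rewrite lt0n mxrank_eq0. Qed.

(** [%/] is exact here: p - 1 and p + 2 differ by 3, so one of them is even. [hG] excludes the empty
    graph, whose adjacency matrix has no eigenvalue. *)
Theorem theorem14 (R : rcfType) (p : nat) (G : sgraph)
  (hp : 2 <= p)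
  (hG : 0 < #|G|)
  (hfree : induced_free (star p.+1) G)
  (hreg : regular (2 * p) G)
  (hcol : star_colourable (p + 2) G) :
  [/\ eigenvalue (adjmx R G) (- 2%:R)%R,
      ((p - 1) * (p + 2)) %/ 2 <= eigen_mult (adjmx R G) (- 2%:R)%R,
      eigenvalue (adjmx R G) (p%:R - 2%:R)%R
    & p + 1 <= eigen_mult (adjmx R G) (p%:R - 2%:R)%R].

Proof.
case: hcol => f starf.
have m1 := eigen_mult_neg2 R hp hG hreg starf hfree.
have m2 := eigen_mult_sub2 R hp hG hreg starf hfree.
split=> //; apply: eigen_mult_gt0; last by apply: leq_trans m2; rewrite addn1.
by apply: leq_trans m1; nia.
Qed.
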